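(* Let $p$ be a prime and $\Phi:\mathbb{Z}_p\to\mathbb{Z}_p$. For $n\in\mathbb{N}$ let $\varphi_n=\pi^p_n\circ\Phi\circ\iota^p_n:\mathbb{Z}/p^n\mathbb{Z}\to\mathbb{Z}/p^n\mathbb{Z}$. The following are equivalent: (1) $\Phi$ is congruence preserving; (2) $\Phi$ is 1-Lipschitz, every $\varphi_n$ is congruence preserving (for all $x,y\in\mathbb{Z}/p^n\mathbb{Z}$, $x-y$ divides $\varphi_n(x)-\varphi_n(y)$ in $\mathbb{Z}/p^n\mathbb{Z}$), and $\Phi$ is the inverse limit of the $\varphi_n$, i.e. for all $1\le m\le n$, $\pi^p_n\circ\Phi=\varphi_n\circ\pi^p_n$ and $\pi^p_{n,m}\circ\varphi_n=\varphi_m\circ\pi^p_{n,m}$. The analogous equivalence holds for $\Phi:\widehat{\mathbb{Z}}\to\widehat{\mathbb{Z}}$, with $p^n$ replaced by $n!$ throughout.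
   Context: $\mathbb{Z}_p=\varprojlim\mathbb{Z}/p^n\mathbb{Z}$ with ultrametric $d(x,y)=2^{-n}$, $n$ largest with $p^n\mid x-y$. $\pi^p_n:\mathbb{Z}_p\to\mathbb{Z}/p^n\mathbb{Z}$ is the canonical projection; $\iota^p_n:\mathbb{Z}/p^n\mathbb{Z}\to\mathbb{Z}_p$ maps a class to its representative in $\{0,\dots,p^n-1\}$; $\pi^p_{n,m}:\mathbb{Z}/p^n\mathbb{Z}\to\mathbb{Z}/p^m\mathbb{Z}$ ($m\le n$) is the canonical surjection. $\widehat{\mathbb{Z}}=\varprojlim\mathbb{Z}/n!\mathbb{Z}$ with ultrametric $d(x,y)=2^{-n}$, $n$ largest with $n!\mid x-y$, and the analogous maps. A function $\Phi:R\to R$ on a commutative ring $R$ is congruence preserving if for all $x,y\in R$ there is $d\in R$ with $\Phi(x)-\Phi(y)=d(x-y)$. $\Phi$ is 1-Lipschitz if $d(x,y)\le2^{-n}$ implies $d(\Phi(x),\Phi(y))\le2^{-n}$ for all $n$. *)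

(* Defs.v *)
From HB Require Import structures.
From mathcomp Require Import all_boot all_order all_algebra.
From mathcomp Require Import boolp classical_sets.

Set Implicit Arguments.
Unset Strict Implicit.
Unset Printing Implicit Defensive.

Import Order.TTheory GRing.Theory Num.Theory.
Local Open Scope ring_scope.

(* Z/mZ for m > 0, including the zero ring Z/1Z (whereas 'Z_1 is Z/2Z).
   The elements are the representatives 0, ..., m - 1. *)
Definition ZMod (m : nat) : Type := 'I_m.-1.+1.

HB.instance Definition _ (m : nat) := Finite.on (ZMod m).
HB.instance Definition _ (m : nat) := GRing.Zmodule.on (ZMod m).

Fact ZMod_mul1 (m : nat) : left_id (Zp1 : ZMod m) (@Zp_mul _).
Proof. exact: Zp_mul1z. Qed.

Fact ZMod_mulDl (m : nat) :
  left_distributive (@Zp_mul _ : ZMod m -> ZMod m -> ZMod m) +%R.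
Proof. exact: Zp_mul_addl. Qed.

HB.instance Definition _ (m : nat) :=
  GRing.Zmodule_isComPzRing.Build (ZMod m)
    (@Zp_mulA _) (@Zp_mulC _) (@ZMod_mul1 m) (@ZMod_mulDl m).

(* The class mod m of the representative of x : Z/nZ; this is the canonical
   surjection when m divides n. *)
Definition ZMod_proj (n m : nat) (x : ZMod n) : ZMod m := inZp x.

Record divchain := DivChain {
  modulus :> nat -> nat;
  modulus0 : modulus 0%N = 1%N;
  modulus_gt0 : forall n, (0 < modulus n)%N;
  modulus_dvd : forall m n, (m <= n)%N -> (modulus m %| modulus n)%N }.

Section InverseLimit.
Variable a : divchain.

Lemma ZMod_projD m n (x y : ZMod (a n)) : (m <= n)%N ->
  ZMod_proj (a m) (x + y) = ZMod_proj (a m) x + ZMod_proj (a m) y.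
Proof.
move=> mn; apply: val_inj => /=; rewrite modnDm.
by rewrite modn_dvdm // !prednK ?modulus_gt0 // modulus_dvd.
Qed.

Lemma ZMod_projM m n (x y : ZMod (a n)) : (m <= n)%N ->
  ZMod_proj (a m) (x * y) = ZMod_proj (a m) x * ZMod_proj (a m) y.
Proof.
move=> mn; apply: val_inj => /=; rewrite modnMm.
by rewrite modn_dvdm // !prednK ?modulus_gt0 // modulus_dvd.
Qed.

Lemma ZMod_proj0 m n : ZMod_proj (a m) (0 : ZMod (a n)) = 0.
Proof. by apply: val_inj; rewrite /= mod0n. Qed.

Lemma ZMod_proj1 m n : (m <= n)%N -> ZMod_proj (a m) (1 : ZMod (a n)) = 1.
Proof.
move=> mn; apply: val_inj => /=.
by rewrite modn_dvdm // !prednK ?modulus_gt0 // modulus_dvd.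
Qed.

Lemma ZMod_projN m n (x : ZMod (a n)) : (m <= n)%N ->
  ZMod_proj (a m) (- x) = - ZMod_proj (a m) x.
Proof.
move=> mn; apply: (addrI (ZMod_proj (a m) x)).
by rewrite -ZMod_projD // !subrr ZMod_proj0.
Qed.

Record invlim := InvLim {
  invlim_pi : forall n, ZMod (a n);
  invlim_compat : forall m n, (m <= n)%N ->
    ZMod_proj (a m) (invlim_pi n) = invlim_pi m }.

Lemma invlim_ext (x y : invlim) :
  (forall n, invlim_pi x n = invlim_pi y n) -> x = y.
Proof.
case: x y => [x cx] [y cy] /= xy.
have {}xy : x = y by apply: functional_extensionality_dep.
by rewrite xy in cx *; congr InvLim; apply: Prop_irrelevance.
Qed.

HB.instance Definition _ := gen_eqMixin invlim.
HB.instance Definition _ := gen_choiceMixin invlim.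

Program Definition invlim_zero := @InvLim (fun n => 0) _.
Next Obligation. by rewrite ZMod_proj0. Qed.

Program Definition invlim_one := @InvLim (fun n => 1) _.
Next Obligation. by rewrite ZMod_proj1. Qed.

Program Definition invlim_opp (x : invlim) :=
  @InvLim (fun n => - invlim_pi x n) _.
Next Obligation. by rewrite ZMod_projN // invlim_compat. Qed.

Program Definition invlim_add (x y : invlim) :=
  @InvLim (fun n => invlim_pi x n + invlim_pi y n) _.
Next Obligation. by rewrite ZMod_projD // !invlim_compat. Qed.

Program Definition invlim_mul (x y : invlim) :=
  @InvLim (fun n => invlim_pi x n * invlim_pi y n) _.
Next Obligation. by rewrite ZMod_projM // !invlim_compat. Qed.

Fact invlim_addA : associative invlim_add.
Proof. by move=> x y z; apply: invlim_ext => n /=; rewrite addrA. Qed.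

Fact invlim_addC : commutative invlim_add.
Proof. by move=> x y; apply: invlim_ext => n /=; rewrite addrC. Qed.

Fact invlim_add0 : left_id invlim_zero invlim_add.
Proof. by move=> x; apply: invlim_ext => n /=; rewrite add0r. Qed.

Fact invlim_addN : left_inverse invlim_zero invlim_opp invlim_add.
Proof. by move=> x; apply: invlim_ext => n /=; rewrite addNr. Qed.

HB.instance Definition _ := GRing.isZmodule.Build invlim
  invlim_addA invlim_addC invlim_add0 invlim_addN.

Fact invlim_mulA : associative invlim_mul.
Proof. by move=> x y z; apply: invlim_ext => n /=; rewrite mulrA. Qed.

Fact invlim_mulC : commutative invlim_mul.
Proof. by move=> x y; apply: invlim_ext => n /=; rewrite mulrC. Qed.

Fact invlim_mul1 : left_id invlim_one invlim_mul.
Proof. by move=> x; apply: invlim_ext => n /=; rewrite mul1r. Qed.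

Fact invlim_mulDl : left_distributive invlim_mul invlim_add.
Proof. by move=> x y z; apply: invlim_ext => n /=; rewrite mulrDl. Qed.

HB.instance Definition _ := GRing.Zmodule_isComPzRing.Build invlim
  invlim_mulA invlim_mulC invlim_mul1 invlim_mulDl.

Definition invlim_iota (n : nat) (x : ZMod (a n)) : invlim := (val x)%:R.

Lemma invlim_pi_nat m n : invlim_pi (m%:R : invlim) n = inZp m.
Proof.
elim: m => [|m IH]; first by apply: val_inj; rewrite /= mod0n.
rewrite -[m.+1]addn1 natrD -[LHS]/(invlim_pi m%:R n + 1) IH.
by apply: val_inj; rewrite /= modnDm.
Qed.

Lemma invlim_iotaK n (x : ZMod (a n)) : invlim_pi (invlim_iota x) n = x.
Proof. by rewrite invlim_pi_nat valZpK. Qed.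

Definition level_map (Phi : invlim -> invlim) (n : nat) :
    ZMod (a n) -> ZMod (a n) :=
  fun x => invlim_pi (Phi (invlim_iota x)) n.

Definition is_inverse_limit (Phi : invlim -> invlim)
    (phi : forall n, ZMod (a n) -> ZMod (a n)) : Prop :=
  forall m n, (1 <= m <= n)%N ->
    (forall x : invlim, invlim_pi (Phi x) n = phi n (invlim_pi x n)) /\
    (forall x : ZMod (a n),
       ZMod_proj (a m) (phi n x) = phi m (ZMod_proj (a m) x)).

End InverseLimit.

Arguments level_map {a} Phi n x.

Definition rdivides (R : comPzRingType) (d x : R) : Prop :=
  exists z : R, x = z * d.

Definition congruence_preserving (R : comPzRingType) (Phi : R -> R) : Prop :=
  forall x y : R, exists d : R, Phi x - Phi y = d * (x - y).

Section Ultrametric.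
Variable a : divchain.
Implicit Types x y : invlim a.

Definition is_valuation (x : invlim a) (n : nat) : Prop :=
  rdivides (a n)%:R x /\ forall k, rdivides (a k)%:R x -> (k <= n)%N.

Definition valuation (x : invlim a) : nat := xget 0%N [set n | is_valuation x n].

Lemma invlim_pi_dvd k n x :
  (n <= k)%N -> rdivides (a k)%:R x -> invlim_pi x n = 0.
Proof.
move=> nk [z ->]; rewrite -[LHS]/(invlim_pi z n * invlim_pi (a k)%:R n).
suff -> : invlim_pi (a k)%:R n = 0 :> ZMod (a n) by rewrite mulr0.
rewrite invlim_pi_nat; apply: val_inj => /=.
by rewrite prednK ?modulus_gt0 //; apply/eqP/modulus_dvd.
Qed.

Lemma valuationP x : x <> 0 -> is_valuation x (valuation x).
Proof.
move=> x0; have [n xn] : exists n, invlim_pi x n <> 0.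
  apply: contrapT => h; apply: x0; apply: invlim_ext => n.
  by apply: contrapT => xn; apply: h; exists n.
suff [v xv] : exists v, is_valuation x v by apply: (xgetPex 0%N); exists v.
pose P k := `[< rdivides (a k)%:R x >].
have exP : exists k, P k.
  by exists 0%N; apply/asboolP; exists x; rewrite modulus0 mulr1.
have ubP k : P k -> (k <= n)%N.
  move=> /asboolP xk; rewrite leqNgt; apply/negP => nk.
  exact/xn/(invlim_pi_dvd (ltnW nk) xk).
case: (ex_maxnP exP ubP) => v /asboolP xv vmax.
by exists v; split=> // k xk; apply: vmax; apply/asboolP.
Qed.

(* All distances are 0 or of the form 2^-n, so rational values suffice. *)
Definition dist x y : rat :=
  if x == y then 0 else 2^-1 ^+ valuation (x - y).

Definition lipschitz1 (Phi : invlim a -> invlim a) : Prop :=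
  forall (n : nat) x y,
    dist x y <= 2^-1 ^+ n -> dist (Phi x) (Phi y) <= 2^-1 ^+ n.

End Ultrametric.

Fact expn_gt0_prime (p : nat) (p_pr : prime p) n : (0 < p ^ n)%N.
Proof. by rewrite expn_gt0 prime_gt0. Qed.

Fact dvdn_factorial m n : (m <= n)%N -> (m`! %| n`!)%N.
Proof.
by elim: n => [|n IH]; rewrite leq_eqVlt => /predU1P[->//|//] /IH/dvdn_mull->.
Qed.

Definition padic_chain (p : nat) (p_pr : prime p) : divchain :=
  @DivChain (fun n => p ^ n)%N (expn0 p)
    (fun n => expn_gt0_prime p_pr n) (fun m n => @dvdn_exp2l p m n).

Definition factorial_chain : divchain :=
  @DivChain (fun n => n`!)%N fact0 fact_gt0 dvdn_factorial.

Definition padic_int (p : nat) (p_pr : prime p) : Type :=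
  invlim (padic_chain p_pr).

Definition profinite_int : Type := invlim factorial_chain.

(* Main.v *)
Require Import Defs.
From mathcomp Require Import all_boot all_order all_algebra.
From mathcomp Require Import boolp.

Set Implicit Arguments.
Unset Strict Implicit.
Unset Printing Implicit Defensive.

Import Order.TTheory GRing.Theory Num.Theory.
Local Open Scope ring_scope.

(** Reduction mod [a n] is a ring morphism determining the class of [x - y], so
    congruence preservation passes to every level, and divisibility by [a n]
    is what the distance measures. Conversely, at each finite level the
    quotients [d] with [Phi x - Phi y = d * (x - y)] form a nonempty finite
    set; a compactness argument in the inverse limit of finite rings glues them
    to a single global quotient. *)

Section CongruencePreserving.
Variable a : divchain.
Implicit Types x y u v : invlim a.

Lemma invlim_piB x y n : invlim_pi (x - y) n = invlim_pi x n - invlim_pi y n.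
Proof. by []. Qed.

Lemma invlim_piM x y n : invlim_pi (x * y) n = invlim_pi x n * invlim_pi y n.
Proof. by []. Qed.

Lemma invlim_pi_le m n x y : (m <= n)%N ->
  invlim_pi x n = invlim_pi y n -> invlim_pi x m = invlim_pi y m.
Proof. by move=> mn xy; rewrite -(invlim_compat x mn) xy invlim_compat. Qed.

Lemma rdivides_modulus_le m n x : (m <= n)%N ->
  rdivides (a n)%:R x -> rdivides (a m)%:R x.
Proof.
move=> /(modulus_dvd a)/dvdnP[q ->] [z ->].
by exists (z * q%:R); rewrite natrM mulrA.
Qed.

(** For [x <> y], the levels whose modulus divides [x - y] are exactly those up to
    [valuation (x - y)], because the moduli form a divisibility chain. *)
Lemma dist_le_rdivides x y n :
  dist x y <= 2^-1 ^+ n <-> rdivides (a n)%:R (x - y).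
Proof.
rewrite /dist; case: eqP => [->|/eqP xy].
  split=> _; last by rewrite exprn_ge0.
  by exists 0; rewrite subrr mul0r.
have [dv maxv] : is_valuation (x - y) (valuation (x - y)).
  by apply: valuationP; apply/eqP; rewrite subr_eq0.
rewrite ler_iXn2l //; split=> [nv|]; last exact: maxv.
exact: rdivides_modulus_le nv dv.
Qed.

(* Koenig's lemma: [Ext n c] says that the ball of radius [n] around [c] meets
   every [P k]; since it splits into finitely many balls of radius [n.+1], one
   of those has the same property. *)
Lemma invlim_compact (P : nat -> invlim a -> Prop) :
  (forall n, exists x, P n x) ->
  (forall m n x, (m <= n)%N -> P n x -> P m x) ->
  (forall n x y, invlim_pi x n = invlim_pi y n -> P n x -> P n y) ->
  exists x, forall n, P n x.
Proof.
move=> exP anti loc.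
pose Ext n c := forall k, exists2 e, invlim_pi e n = invlim_pi c n & P k e.
(* The hypothesis [Ext] sits under the existential so that [choice] yields a total function, which
   can then be iterated. *)
have step (nc : nat * invlim a) : exists c', Ext nc.1 nc.2 ->
    invlim_pi c' nc.1 = invlim_pi nc.2 nc.1 /\ Ext nc.1.+1 c'.
  case: nc => n c /=; have [extc|] := pselect (Ext n c); last by exists c.
  apply: contrapT => noc.
  (* If no smaller ball works, each residue [d] fails at some level [K d]. A point of the ball
     satisfying [P] at the maximum of these levels satisfies it at [K] of its own residue, a
     contradiction. *)
  have bad (d : ZMod (a n.+1)) : exists k, forall e, invlim_pi e n.+1 = d ->
      invlim_pi e n = invlim_pi c n -> ~ P k e.
    apply: contrapT => nok; apply: noc.
    have ext k : exists e, [/\ invlim_pi e n.+1 = d,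
        invlim_pi e n = invlim_pi c n & P k e].
      apply: contrapT => noe; apply: nok; exists k => e ed ec Pe.
      by apply: noe; exists e.
    have [e0 [e0d e0c _]] := ext 0%N.
    exists e0 => _; split=> // k.
    by have [e [ed _ Pe]] := ext k; exists e => //; rewrite ed.
  have [K badK] := choice bad.
  have [e ec Pe] := extc (\max_d K d)%N.
  apply: (badK _ e erefl ec); apply: anti Pe.
  exact: (leq_bigmax (F := K)).
have [f fP] := choice step.
have [x0 _] := exP 0%N.
pose s := fix s n := if n is m.+1 then f (m, s m) else x0.
have ext0 : Ext 0%N x0.
  move=> k; have [e Pe] := exP k; exists e => //.
  (* Level 0 is the zero ring, so the ball of radius 0 is the whole space. *)
  apply: val_inj; move: (invlim_pi e 0) (invlim_pi x0 0); rewrite modulus0.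
  by move=> u v; rewrite (ord1 u) (ord1 v).
have exts n : Ext n (s n).
  by elim: n => [//|n IH]; have [] := fP (n, s n) IH.
have sS n : invlim_pi (s n.+1) n = invlim_pi (s n) n.
  by have [] := fP (n, s n) (exts n).
have s_le m n : (m <= n)%N -> invlim_pi (s n) m = invlim_pi (s m) m.
  elim: n => [|n IH]; first by rewrite leqn0 => /eqP->.
  rewrite leq_eqVlt => /predU1P[->//|mn]; rewrite -IH //.
  exact: invlim_pi_le (sS n).
have sc m n : (m <= n)%N ->
    ZMod_proj (a m) (invlim_pi (s n) n) = invlim_pi (s m) m.
  by move=> mn; rewrite invlim_compat // s_le.
exists (InvLim sc) => n.
by have [e es Pe] := exts n n; apply: loc Pe.
Qed.

(** Quotients chosen level by level need not be compatible, since [v] may be a zero divisor modulo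
    [a n]. But being a quotient at level [n] depends only on the class modulo [a n] and descends to
    lower levels, so compactness applies. *)
Lemma rdivides_invlim u v :
  (forall n, rdivides (invlim_pi v n) (invlim_pi u n)) -> rdivides v u.
Proof.
move=> dvd.
have [||| d dP] :=
  @invlim_compact (fun n d => invlim_pi u n = invlim_pi (d * v) n).
- move=> n; have [z zP] := dvd n.
  by exists (invlim_iota z); rewrite invlim_piM invlim_iotaK.
- by move=> m n d mn; apply: (invlim_pi_le mn).
- by move=> n d e de; rewrite !invlim_piM de.
by exists d; apply: invlim_ext.
Qed.

Lemma congruence_preserving_pi (Phi : invlim a -> invlim a) n x y :
  congruence_preserving Phi ->
  invlim_pi x n = invlim_pi y n -> invlim_pi (Phi x) n = invlim_pi (Phi y) n.
Proof.
move=> cp xy; have [d] := cp x y => /(congr1 (fun z => invlim_pi z n)).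
by rewrite invlim_piM !invlim_piB xy subrr mulr0 => /subr0_eq.
Qed.

Lemma congruence_preserving_levels (Phi : invlim a -> invlim a) :
  congruence_preserving Phi <->
  [/\ lipschitz1 Phi,
      forall n : nat, congruence_preserving (level_map Phi n)
    & is_inverse_limit Phi (level_map Phi)].
Proof.
split=> [cp|[_ cpl lim] x y].
  split.
  - move=> n x y /dist_le_rdivides[z xy]; apply/dist_le_rdivides.
    by have [d ->] := cp x y; exists (d * z); rewrite xy mulrA.
  - move=> n x y; have [d dP] := cp (invlim_iota x) (invlim_iota y).
    exists (invlim_pi d n).
    by rewrite /level_map -invlim_piB dP invlim_piM invlim_piB !invlim_iotaK.
  - move=> m n /andP[_ mn]; split=> x.
      by apply: congruence_preserving_pi => //; rewrite invlim_iotaK.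
    (* The representatives of [x] and of its projection may differ, but they agree at level [m]. *)
    rewrite /level_map invlim_compat //; apply: congruence_preserving_pi => //.
    by rewrite invlim_iotaK -(invlim_compat _ mn) invlim_iotaK.
suff: rdivides (x - y) (Phi x - Phi y) by [].
apply: rdivides_invlim => n.
(* [is_inverse_limit] says nothing at level 0. *)
have [limS _] := lim n.+1 n.+1 (leqnn _).
have [d] := cpl n.+1 (invlim_pi x n.+1) (invlim_pi y n.+1).
rewrite -!limS -!invlim_piB => /(congr1 (ZMod_proj (a n))).
by rewrite ZMod_projM // !invlim_compat //; exists (ZMod_proj (a n) d).
Qed.

End CongruencePreserving.

Theorem theorem20 :
  (forall (p : nat) (p_pr : prime p) (Phi : padic_int p_pr -> padic_int p_pr),
     congruence_preserving Phi <->
     [/\ lipschitz1 Phi,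
         forall n : nat, congruence_preserving (level_map Phi n)
       & is_inverse_limit Phi (level_map Phi)]) /\
  (forall Phi : profinite_int -> profinite_int,
     congruence_preserving Phi <->
     [/\ lipschitz1 Phi,
         forall n : nat, congruence_preserving (level_map Phi n)
       & is_inverse_limit Phi (level_map Phi)]).
Proof.
by split=> [p p_pr|] Phi; apply: congruence_preserving_levels.
Qed.
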